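(* There are four distinct infinite families of groups, each of the form $\mathcal{H}=\{H_j\}_{j=1}^{\infty}$, such that in each family and for every integer $j\geq 1$ the group $H_j$ is a $4$-generator $2$-group of order $2^{5+j}$ and nilpotency class $j+1$ with $\mathrm{Out}_c(H_j)\neq 1$. Here the four families are distinct in the sense that for every $j\geq 1$ the $j$-th members of the four families are pairwise non-isomorphic groups.
   Context: For a group $G$, $\mathrm{Aut}(G)$ acts on the set of conjugacy classes of $G$; $\mathrm{Aut}_c(G)$ denotes the kernel of this action, i.e. the group of automorphisms $\alpha$ such that $\alpha(g)$ is conjugate to $g$ in $G$ for every $g\in G$ (called nearly inner, or class-preserving, automorphisms). $\mathrm{Inn}(G)\leq \mathrm{Aut}_c(G)$ is the subgroup of inner automorphisms, and $\mathrm{Out}_c(G):=\mathrm{Aut}_c(G)/\mathrm{Inn}(G)$. A $p$-group is called a $d$-generator group if it is minimally generated by $d$ elements. The nilpotency class of a nilpotent group $G$ is the smallest $c$ with $\gamma_{c+1}(G)=1$, where $\gamma_1(G)=G$ and $\gamma_{i+1}(G)=[G,\gamma_i(G)]$. *)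

(* Defs.v *)
From mathcomp Require Import all_boot all_fingroup all_solvable.

Set Implicit Arguments.
Unset Strict Implicit.
Unset Printing Implicit Defensive.

Local Open Scope group_scope.

Section ClassPreserving.

Variables (gT : finGroupType) (G : {group gT}).

(* The action is that of permutations of gT on sets, alpha : C |-> alpha @: C. *)
Definition Aut_c : {set {perm gT}} := 'C_(Aut G)(classes G | 'P^*).
Canonical Aut_c_group := Eval hnf in [group of Aut_c].

(* conj_aut G x is the automorphism g |-> g ^ x of G. *)
Definition Inn : {set {perm gT}} := conj_aut G @* G.
Canonical Inn_group := Eval hnf in [group of Inn].

Definition Out_c : {set coset_of Inn} := Aut_c / Inn.
Canonical Out_c_group := Eval hnf in [group of Out_c].

Lemma Aut_cP (a : {perm gT}) :
  reflect (a \in Aut G /\ {in G, forall g, a g \in g ^: G}) (a \in Aut_c).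
Proof.
have imE (C : {set gT}) : 'P^*%act C a = a @: C by [].
apply: (iffP idP) => [|[Aa cl_a]].
  case/setIP=> Aa /astabP stab; split=> // g Gg.
  have := stab _ (mem_classes Gg); rewrite imE => <-.
  by apply: imset_f; apply: class_refl.
apply/setIP; split=> //; apply/astabP=> _ /imsetP[g Gg ->]; rewrite imE.
apply/eqP; rewrite eqEcard (card_imset _ (@perm_inj _ a)) leqnn andbT.
apply/subsetP=> _ /imsetP[_ /imsetP[x Gx ->] ->].
by rewrite -(class_eqP (memJ_class g Gx)) cl_a ?groupJ.
Qed.

Lemma Inn_normal : Inn <| Aut_c.
Proof.
apply/andP; split.
  apply/subsetP=> _ /morphimP[x _ Gx ->]; apply/Aut_cP; split.
    by rewrite (subsetP (Aut_conj_aut G G)) // mem_morphim // (subsetP (normG G)).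
  by move=> g Gg; rewrite /= conj_autE // memJ_class.
apply/subsetP=> a /Aut_cP[Aa _]; rewrite inE.
apply/subsetP=> _ /imsetP[_ /morphimP[x Nx Gx ->] ->].
have Gax : a x \in G by rewrite Aut_closed.
have Nax := subsetP (normG G) _ Gax.
suff -> : conj_aut G x ^ a = conj_aut G (a x) by apply: mem_morphim.
have inA y : y \in G -> conj_aut G y \in Aut G.
  by move=> Gy; rewrite (subsetP (Aut_conj_aut G G)) // mem_morphim // (subsetP (normG G)).
apply: (@eq_Aut _ G); rewrite ?groupJ ?inA // => y Gy.
have [z Gz ->] : exists2 z, z \in G & y = a z.
  exists (a^-1 y); last by rewrite permKV.
  by rewrite Aut_closed ?groupV.
rewrite conjgE !permM permK !conj_autE ?Aut_closed //.
by rewrite -!(autmE Aa) morphJ.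
Qed.

End ClassPreserving.

(* Main.v *)
(** Let A = <x> x <y> be the direct product of cyclic groups of orders 2^(n+2)
and 4, and put z = x^(2^(n+1)) and u = y^2. The groups are the extensions of A
by the Klein four-group generated by the images of s and t, where s inverts A,
t centralises y and maps x to x u, and
  t^2 = 1,   s^2 = z^p u^q,   [s, t] = z^r,
the exponents (p, q, r) being (0,0,0), (0,0,1), (0,1,0) or (1,0,0). The lower
central series drops from <x^2, y^2> through the powers <x^(2^i)>.

The map fixing A and s and sending t to t u is an automorphism because u is a
central involution. It preserves classes: for a in A, a t is conjugate to a t u
by x, and a s t is conjugate to a s t u by y. It is not inner: A is
self-centralising, and the elements of A that commute with s have order at most
2, hence are even powers of x times powers of y and so commute with t.

The four groups are told apart by the number of solutions of g^2 = 1. It is the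
same for all four on A and on A t; the coset A s consists of solutions if
p = q = 0 and contains none otherwise; the solutions in A s t are the
x^i y^k s t with i of the parity of q if p = r, and there are none otherwise. *)

Require Import Defs.
From HB Require Import structures.
From mathcomp Require Import all_boot all_fingroup all_solvable.
From mathcomp Require Import ssralg zmodp ring zify.

Import GRing.Theory.

Local Open Scope group_scope.

(** * Parities and signs in Z/2^(n+2) and Z/4 *)

Lemma Zp_cast_pow2 n : (Zp_trunc (2 ^ n.+2)).+2 = (2 ^ n.+2)%N.
Proof. by apply: Zp_cast; rewrite -[1%N](expn0 2) ltn_exp2l. Qed.

(** Addition in ['Z_m] is reduced modulo [(Zp_trunc m).+2], which equals 2^(n+2) by [Zp_cast_pow2]
    but does not compute to it. *)
Lemma val_ZpD n (x y : 'Z_(2 ^ n.+2)) :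
  (x + y)%R = ((x + y) %% 2 ^ n.+2)%N :> nat.
Proof. exact: (congr1 (modn (x + y)%N) (Zp_cast_pow2 n)). Qed.

Lemma val_Zp_nat n m : (m%:R : 'Z_(2 ^ n.+2))%R = (m %% 2 ^ n.+2)%N :> nat.
Proof. by rewrite Zp_nat /=; exact: (congr1 (modn m) (Zp_cast_pow2 n)). Qed.

Lemma dvd_valD n d (x y : 'Z_(2 ^ n.+2)) :
  (d %| 2 ^ n.+2 -> d %| x -> d %| y -> d %| (x + y)%R)%N.
Proof. by move=> dN dx dy; rewrite val_ZpD /dvdn modn_dvdm // [_ == _]dvdn_add. Qed.

(** Parity makes sense because the modulus is even; t acts on x^i through the parity of i. *)
Definition oddz {n} (x : 'Z_(2 ^ n.+2)) := odd x.

Lemma oddzD n (x y : 'Z_(2 ^ n.+2)) : oddz (x + y)%R = oddz x (+) oddz y.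
Proof. by rewrite /oddz val_ZpD odd_mod ?oddX ?oddD. Qed.

Lemma oddzN n (x : 'Z_(2 ^ n.+2)) : oddz (- x)%R = oddz x.
Proof. by have := oddzD n x (- x)%R; rewrite subrr; case: (oddz x); case: (oddz (- x)%R). Qed.

Lemma oddz0 n : oddz (0%R : 'Z_(2 ^ n.+2)) = false. Proof. by []. Qed.

Lemma oddz1 n : oddz (1%R : 'Z_(2 ^ n.+2)).
Proof. by rewrite -[1%R]/(1%:R)%R /oddz val_Zp_nat odd_mod ?oddX. Qed.

(** The modulus is a multiple of 4, so 4 divides 2x. *)
Lemma two_torsion_even n (x : 'Z_(2 ^ n.+2)) : (x + x = 0)%R -> oddz x = false.
Proof.
move=> xx; have: (2 ^ n.+2 %| x + x)%N by rewrite /dvdn -val_ZpD xx.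
have d4: (2 * 2 %| 2 ^ n.+2)%N by rewrite !expnS mulnA dvdn_mulr.
by move/(dvdn_trans d4); rewrite addnn -mul2n dvdn_pmul2l // dvdn2 => /negPf.
Qed.

Definition half n : 'Z_(2 ^ n.+2) := (2 ^ n.+1)%:R%R.

Lemma halfD n : (half n + half n = 0)%R.
Proof. by apply: val_inj; rewrite -natrD /= val_Zp_nat addnn -mul2n -expnS modnn. Qed.

Lemma oddz_half n : oddz (half n) = false.
Proof. by rewrite /oddz val_Zp_nat odd_mod ?oddX. Qed.

Definition sg {V : zmodType} (s : bool) (x : V) : V := (if s then - x else x)%R.
Definition zz n (b : bool) : 'Z_(2 ^ n.+2) := if b then half n else 0%R.
Definition tw (b : bool) : 'Z_4 := (if b then 2%:R else 0)%R.

Lemma sgD (V : zmodType) s (x y : V) : (sg s (x + y) = sg s x + sg s y)%R.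
Proof. by case: s => //=; rewrite opprD. Qed.

Lemma sgM (V : zmodType) s t (x : V) : (sg s (sg t x) = sg (s (+) t) x)%R.
Proof. by case: s; case: t => //=; rewrite opprK. Qed.

Lemma zzD n a b : zz n (a (+) b) = (zz n a + zz n b)%R.
Proof. by case: a; case: b; rewrite /= ?addr0 ?add0r ?halfD. Qed.

Lemma sg_zz n s b : sg s (zz n b) = zz n b.
Proof.
case: s; case: b; rewrite /= ?oppr0 //.
by apply/eqP; rewrite eq_sym -addr_eq0 halfD.
Qed.

Lemma twD a b : tw (a (+) b) = (tw a + tw b)%R.
Proof. by case: a; case: b; apply: val_inj. Qed.

Lemma sg_tw s b : sg s (tw b) = tw b.
Proof. by case: s; case: b; apply: val_inj. Qed.

Lemma oddz_sg n s (x : 'Z_(2 ^ n.+2)) : oddz (sg s x) = oddz x.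
Proof. by case: s => //; apply: oddzN. Qed.

Lemma oddz_zz n b : oddz (zz n b) = false.
Proof. by case: b => //; apply: oddz_half. Qed.

(** * The group law of the extension *)

(* Ext i k a b stands for x^i y^k s^a t^b. *)
Record ext (n : nat) (p q r : bool) : Type := Ext {
  ex : 'Z_(2 ^ n.+2); ey : 'Z_4; es : bool; et : bool }.

Arguments Ext {n p q r}.
Arguments ex {n p q r}.
Arguments ey {n p q r}.
Arguments es {n p q r}.
Arguments et {n p q r}.

Section Extension.

Variables (n : nat) (p q r : bool).
Local Notation E := (ext n p q r).

Definition ext_tuple (g : E) := (ex g, ey g, es g, et g).
Definition tuple_ext (w : 'Z_(2 ^ n.+2) * 'Z_4 * bool * bool) : E :=
  let: (x, y, s, t) := w in Ext x y s t.

Lemma ext_tupleK : cancel ext_tuple tuple_ext. Proof. by case. Qed.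
Lemma tuple_extK : cancel tuple_ext ext_tuple. Proof. by case=> [[[]]]. Qed.

HB.instance Definition _ := Finite.copy E (can_type ext_tupleK).

Definition ext_one : E := Ext 0%R 0%R false false.
(* zz b is z^b and tw b is u^b. The term t && oddz x' is the action of t; the
   terms in p, q and r form a cocycle, bilinear in (s, t) and (s', t'). *)
Definition ext_mul (g h : E) : E :=
  let: Ext x y s t := g in let: Ext x' y' s' t' := h in
  Ext (x + sg s x' + zz n (s && s' && p (+) t && s' && r))%R
      (y + sg s y' + tw (t && oddz x' (+) s && s' && q))%R (s (+) s') (t (+) t').
Definition ext_inv (g : E) : E :=
  let: Ext x y s t := g in
  Ext (sg (~~ s) x + zz n (s && p (+) t && s && r))%R
      (sg (~~ s) y + tw (t && oddz x (+) s && q))%R s t.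

Lemma ext_mul1g : left_id ext_one ext_mul.
Proof. by case=> x y s t; rewrite /ext_mul /= !addr0 !add0r. Qed.

Lemma ext_mulVg : left_inverse ext_one ext_inv ext_mul.
Proof.
case=> x y s t; rewrite /ext_mul /ext_one /= !addbb; congr Ext.
  rewrite (addrAC _ (zz n _)) -(addrA _ (zz n _)) -zzD.
  by case: s; case: t; case: p; case: r; rewrite /= ?addr0 ?addNr ?addrN.
rewrite (addrAC _ (tw _)) -(addrA _ (tw _)) -twD.
by case: s; case: t; case: q; case: (oddz x); rewrite /= ?addr0 ?addNr ?addrN.
Qed.

(** The powers of z and u are fixed by s and by t (the exponent of z is even), so each coordinate
    reduces to a Boolean cocycle identity. *)
Lemma ext_mulA : associative ext_mul.
Proof.
case=> x y s t [x' y' s' t'] [x'' y'' s'' t'']; rewrite /ext_mul /= !addbA.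
congr Ext.
  rewrite !sgD sgM sg_zz -!addrA; congr (_ + (_ + _))%R.
  rewrite [RHS]addrCA; congr (_ + _)%R; rewrite -!zzD; congr zz.
  by case: s; case: s'; case: s''; case: t; case: t'; case: t''; case: p; case: r.
rewrite !sgD sgM sg_tw -!addrA; congr (_ + (_ + _))%R.
rewrite [RHS]addrCA; congr (_ + _)%R; rewrite -!twD; congr tw.
rewrite !oddzD oddz_sg oddz_zz addbF.
by case: (oddz x'); case: (oddz x''); case: q; case: s; case: s'; case: s'';
  case: t; case: t'; case: t''.
Qed.

HB.instance Definition _ :=
  Finite_isGroup.Build E ext_mulA ext_mul1g ext_mulVg.

Lemma extM x y s t x' y' s' t' :
  Ext x y s t * Ext x' y' s' t' = (Ext : _ -> _ -> _ -> _ -> E)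
      (x + sg s x' + zz n (s && s' && p (+) t && s' && r))%R
      (y + sg s y' + tw (t && oddz x' (+) s && s' && q))%R (s (+) s') (t (+) t').
Proof. by []. Qed.

Lemma ext1E : 1 = Ext 0%R 0%R false false :> E. Proof. by []. Qed.

(** * Order, conjugation on A, and squares *)

Lemma card_ext : #|[set: E]| = (2 ^ (n + 6))%N.
Proof.
rewrite cardsT (bij_eq_card (Bijective ext_tupleK tuple_extK)).
rewrite !card_prod !card_bool !card_ord Zp_cast_pow2.
by rewrite !expnS expnD mulnC -[(Zp_trunc 4).+2]/(4%N) -[(2 ^ 6)%N]/(64%N); lia.
Qed.

Lemma extJ x y x' y' s t :
  (Ext x y false false : E) ^ Ext x' y' s t =
  Ext (sg s x) (sg s y + tw (t && oddz x))%R false false.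
Proof.
apply: (mulgI (Ext x' y' s t)); rewrite -conjgC !extM /= !andbF !addr0 !addbF.
rewrite addrC sgM addbb; congr Ext.
by rewrite sgD sgM addbb sg_tw oddz_sg -!addrA -twD addbb addr0 addrC.
Qed.

Lemma extVA x y : (Ext x y false false : E)^-1 = Ext (- x)%R (- y)%R false false.
Proof. by apply/eqP; rewrite eq_invg_mul extM /= !addrN !addr0. Qed.

(** t fixes even powers of x, so only the inversion by s contributes, and it yields the inverse
    square. *)
Lemma extRA x y x' y' s t : oddz x = false ->
  [~ (Ext x y false false : E), Ext x' y' s t] =
  (if s then Ext (- (x + x))%R (- (y + y))%R false false else 1).
Proof.
move=> ox; rewrite commgEl extJ extVA extM ox /= andbF !addr0.
by case: s; rewrite /= ?opprD // !addNr.
Qed.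

Lemma ext_sqr x y s t :
  (Ext x y s t : E) ^+ 2 =
  if s then Ext (zz n (p (+) t && r)) (tw (t && oddz x (+) q)) false false
  else Ext (x + x)%R (y + y + tw (t && oddz x))%R false false.
Proof.
rewrite expgS expg1 extM !addbb.
by case: s; rewrite /= ?andbT ?andbF ?addbF ?addr0 ?addrN ?add0r.
Qed.

(** * Generators and the generator rank *)

Definition gx (m : nat) : E := Ext m%:R%R 0%R false false.
Definition gy (m : nat) : E := Ext 0%R m%:R%R false false.
Definition gs : E := Ext 0%R 0%R true false.
Definition gt : E := Ext 0%R 0%R false true.

Lemma gxX m : gx 1 ^+ m = gx m.
Proof. by elim: m => // m IHm; rewrite expgS IHm extM /= !addr0 -mulrS. Qed.

Lemma gyX m : gy 1 ^+ m = gy m.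
Proof. by elim: m => // m IHm; rewrite expgS IHm extM /= !addr0 -mulrS. Qed.

Lemma gen_ext : <<[set gx 1; gy 1; gs; gt]>> = [set: E].
Proof.
apply/eqP; rewrite -subTset; apply/subsetP=> -[x y s t] _.
have -> : Ext x y s t = gx 1 ^+ x * gy 1 ^+ y * gs ^+ s * gt ^+ t.
  rewrite gxX gyX; case: s; case: t; rewrite ?expg0 ?expg1 ?mulg1 !extM;
    by congr Ext; rewrite /= ?andbF ?odd0 ?addr0 ?add0r ?subr0 ?natr_Zp.
by rewrite !groupM ?groupX // mem_gen // !inE eqxx ?orbT.
Qed.

(** The quotient by the Frattini subgroup <x^2, y^2>, elementary abelian of rank 4; it bounds the
    number of generators from below. *)
Definition frat (g : E) : bool * bool * bool * bool :=
  (oddz (ex g), odd (ey g), es g, et g).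

Lemma oddD4 (y y' : 'Z_4) : odd (y + y')%R = odd y (+) odd y'.
Proof. by rewrite -oddD -(@odd_mod (y + y') 4). Qed.

Lemma odd_sg4 s (y : 'Z_4) : odd (sg s y) = odd y.
Proof. by case: s => //; case: y => [[|[|[|[|]]]]]. Qed.

Lemma odd_tw b : odd (tw b) = false. Proof. by case: b. Qed.

Lemma fratM : {morph frat : g h / g * h}.
Proof.
case=> x y s t [x' y' s' t']; rewrite extM /frat.
cbn [ex ey es et].
by rewrite !oddzD !oddD4 oddz_sg odd_sg4 oddz_zz odd_tw !addbF.
Qed.

Canonical frat_morphism := @Morphism _ _ [set: E] _ (in2W fratM).

Lemma frat_onto : frat @* [set: E] = setT.
Proof.
apply/eqP; rewrite -subTset; apply/subsetP=> -[[[a b] s] t] _.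
apply/morphimP; exists (Ext (a%:R)%R (b%:R)%R s t); rewrite ?inE //.
rewrite /= /frat /= /oddz val_Zp_nat odd_mod ?oddX ?oddb //.
by case: a; case: b.
Qed.

Lemma grank_ext : 'm([set: E]) = 4.
Proof.
apply/eqP; rewrite eqn_leq; apply/andP; split.
  rewrite -gen_ext (leq_trans (grank_min _)) //.
  by rewrite !cardsU !cards1; lia.
have abT : 2.-abelem [set: bool * bool * bool * bool].
  rewrite abelemE // andbC; apply/andP; split.
    by apply/exponentP=> -[[[[] []] []] []] _.
  by apply/centsP; case=> [[[[] []] []] []] _ [[[[] []] []] []] _.
have := morphim_grank frat_morphism (subxx [set: E]).
rewrite /= frat_onto grank_abelian ?(abelem_abelian abT) // (rank_abelem abT).
by rewrite cardsT !card_prod !card_bool.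
Qed.

Lemma pgroup_ext : 2.-group [set: E].
Proof. by rewrite /pgroup card_ext pnatX. Qed.

(** * Lower central series and nilpotency class *)

(* The subgroup <x^2, u> for i = 1, and <x^(2^i)> for 2 <= i <= n + 2. *)
Definition lcn_bound (i : nat) : {set E} :=
  [set g | [&& 2 ^ i %| ex g, ~~ odd (ey g), (1 < i) ==> (ey g == 0%R),
              ~~ es g & ~~ et g]]%N.

Lemma lcn_bound_group_set i : (i <= n.+2)%N -> group_set (lcn_bound i).
Proof.
move=> le_in; apply/group_setP; split; first by rewrite inE /= dvdn0 eqxx implybT.
case=> x y s t [x' y' s' t']; rewrite !inE extM; cbn [ex ey es et].
case/and5P=> dx oy y0 /negPf-> /negPf-> /and5P[dx' oy' y0' /negPf-> /negPf->].
rewrite !addr0 dvd_valD ?dvdn_exp2l // oddD4 (negPf oy) (negPf oy') !andbT /=.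
by apply/implyP=> i1; rewrite (eqP (implyP y0 i1)) (eqP (implyP y0' i1)) addr0.
Qed.

(** Commutators vanish in the abelian image of [frat], which starts the induction; each further
    commutator doubles the exponent of x by [extRA]. *)
Lemma lcn_sub_bound i :
  (i.+1 <= n.+2)%N -> 'L_i.+2([set: E]) \subset lcn_bound i.+1.
Proof.
elim: i => [|i IHi] le_in.
  rewrite lcnSn -[lcn_bound 1]/(gval (Group (lcn_bound_group_set 1 le_in))).
  rewrite gen_subG; apply/subsetP=> _ /imset2P[g h _ _ ->].
  have: frat [~ g, h] = 1.
    rewrite -[frat _]/(frat_morphism _) morphR ?inE //.
    by case: (frat_morphism g) => [[[[] []] []] []];
      case: (frat_morphism h) => [[[[] []] []] []].
  rewrite inE /frat expn1 dvdn2 -/(oddz _).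
  by case=> -> -> -> ->.
have le_in' := ltnW le_in.
rewrite lcnSn (subset_trans (commSg _ (IHi le_in'))) //.
rewrite -[lcn_bound i.+2]/(gval (Group (lcn_bound_group_set _ le_in))) gen_subG.
apply/subsetP=> _ /imset2P[[x y s t] [x' y' s' t'] + _ ->].
rewrite inE; cbn [ex ey es et] => /and5P[dx oy _ /negPf-> /negPf->].
have ox : oddz x = false.
  by apply/negbTE; rewrite -dvdn2 (dvdn_trans _ dx) // dvdn_exp.
rewrite extRA //; case: s'; last by rewrite group1.
rewrite -groupV extVA !opprK.
(* Squaring kills u, so no power of y survives beyond the derived subgroup. *)
have -> : (y + y = 0)%R by case: y oy => [[|[|[|[|]]]]] //= *; apply: val_inj.
rewrite inE; cbn [ex ey es et]; rewrite eqxx implybT andbT.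
rewrite val_ZpD /dvdn modn_dvdm ?dvdn_exp2l // addnn -mul2n.
by have := dvdn_mul (dvdnn 2) dx; rewrite -expnS.
Qed.

Lemma gx_in_lcn i : gx (2 ^ i) \in 'L_i.+1([set: E]).
Proof.
elim: i => [|i IHi]; first by rewrite inE.
(* x itself is an odd power, outside the scope of [extRA]. *)
have [-> | i_gt0] := posnP i.
  rewrite -groupV.
  have -> : (gx (2 ^ 1))^-1 = [~ gx 1, gs].
    rewrite commgEl extJ !extVA extM /= !addr0 ?oppr0 ?addr0.
    by rewrite /gx /= -opprD -natrD.
  by rewrite /= lcnSn mem_commg ?inE.
rewrite -groupV.
have -> : (gx (2 ^ i.+1))^-1 = [~ gx (2 ^ i), gs].
  rewrite extRA /=; last by rewrite /oddz val_Zp_nat odd_mod ?oddX ?eqn0Ngt ?i_gt0.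
  by rewrite extVA addr0 -natrD addnn -mul2n -expnS.
by rewrite /= lcnSn mem_commg ?inE.
Qed.

(** The bound is trivial once 2^(n+2) divides the exponent of x, while z = x^(2^(n+1)) still lies in
    ['L_n.+2]. *)
Lemma nil_class_ext : nil_class [set: E] = n.+2.
Proof.
have nilG := pgroup_nil pgroup_ext.
apply/eqP; rewrite eqn_leq; apply/andP; split.
  apply/(lcn_nil_classP _ nilG)/trivgP.
  apply: subset_trans (lcn_sub_bound _ (leqnn _)) _.
  apply/subsetP=> -[x y s t]; rewrite inE; cbn [ex ey es et].
  case/and5P=> dx _ /eqP-> /negPf-> /negPf->; rewrite inE ext1E; apply/eqP.
  congr Ext; apply: val_inj; rewrite /= -(divnK dx).
  have: x < 2 ^ n.+2 by rewrite -[X in _ < X]Zp_cast_pow2.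
  by move=> /divn_small ->.
rewrite ltnNge; apply/negP=> /(lcn_nil_classP _ nilG) L1.
have := gx_in_lcn n.+1; rewrite L1 inE => /eqP[].
move/(congr1 val); rewrite /= val_Zp_nat modn_small ?ltn_exp2l //.
by move/eqP; rewrite expn_eq0.
Qed.

(** * A class-preserving automorphism that is not inner *)

Definition twist (g : E) : E := Ext (ex g) (ey g + tw (et g))%R (es g) (et g).

Lemma twistK : involutive twist.
Proof. by case=> x y s t; rewrite /twist /= -addrA -twD addbb addr0. Qed.

Lemma twist_Aut : perm (inv_inj twistK) \in Aut [set: E].
Proof.
rewrite inE; apply/andP; split; first by apply/subsetP=> g _; rewrite inE.
apply/morphicP=> -[x y s t] [x' y' s' t'] _ _; rewrite !permE !extM /=.
congr Ext; rewrite sgD sg_tw; cbn [ey et]; rewrite !twD; ring.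
Qed.

Lemma twist_class (g : E) : twist g \in g ^: [set: E].
Proof.
case: g => x y s [|]; last by rewrite /twist /= addr0 class_refl.
(* s inverts y, which t centralises, so y contributes y^2 = u when s occurs; otherwise t moves x by
   u. *)
pose h : E := if s then gy 1 else gx 1.
suff -> : twist (Ext x y s true) = Ext x y s true ^ h by rewrite memJ_class ?inE.
apply: (mulgI h); rewrite -conjgC /h; case: s {h}.
  rewrite !extM /= ?oppr0 !addr0 add0r; congr Ext.
  by apply: val_inj; case: y => [[|[|[|[|]]]]].
by rewrite !extM oddz1 /= !addr0 add0r addrC.
Qed.

Lemma Out_c_ext : Out_c [set: E] != 1.
Proof.
rewrite -subG1 quotient_sub1 ?normal_norm ?Inn_normal //.
apply/subsetPn; exists (perm (inv_inj twistK)).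
  by apply/Aut_cP; split=> [|g _]; rewrite ?twist_Aut // permE twist_class.
apply/negP=> /morphimP[[x y s t] _ _ inn].
have twistE g : Ext x y s t * twist g = g * Ext x y s t.
  by rewrite -[twist g](permE (inv_inj twistK)) inn conj_autE ?inE -?conjgC.
(* A conjugating element must fix y, which excludes s, and then x, which excludes t. *)
have s0 : s = false.
  have := congr1 ey (twistE (gy 1)); rewrite /twist !extM oddz0; cbn [ex ey et gy].
  by rewrite !andbF !addr0 addrC; case: s {twistE inn} => // /addIr.
have t0 : t = false.
  have := congr1 ey (twistE (gx 1)); rewrite s0 /twist !extM oddz1; cbn [ex ey et gx].
  rewrite /= !addr0 add0r andbT addrC; case: t {twistE inn} => // /eqP.
  by rewrite -subr_eq0 addrK.
(* Fixing s forces 2x = 0, so x is even and the element commutes with t, which [twist] moves. *)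
have := congr1 ex (twistE gs); rewrite s0 t0 /twist !extM; cbn [ex gs es et].
rewrite /= !addr0 add0r => xx.
have := congr1 ey (twistE gt); rewrite s0 t0 /twist !extM; cbn [ex ey es et gt].
rewrite (two_torsion_even n x) /=; last by rewrite {1}xx addNr.
by rewrite /= !add0r !addr0 addrC => /eqP; rewrite -subr_eq0 addrK.
Qed.

(** * Counting the solutions of g^2 = 1 *)

Lemma half_neq0 : half n != 0%R.
Proof.
apply/eqP=> /(congr1 (@nat_of_ord _)); rewrite val_Zp_nat modn_small ?ltn_exp2l //.
by move/eqP; rewrite expn_eq0.
Qed.

Lemma zz_eq0 b : (zz n b == 0%R) = ~~ b.
Proof. by case: b; rewrite ?eqxx ?(negPf half_neq0). Qed.

Lemma tw_eq0 b : (tw b == 0%R) = ~~ b. Proof. by case: b. Qed.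

Lemma extA_eq1 x y : (Ext x y false false == 1 :> E) = (x == 0%R) && (y == 0%R).
Proof.
apply/eqP/andP=> [g1 | [/eqP-> /eqP->]] //.
by split; apply/eqP; [apply: (congr1 ex g1) | apply: (congr1 ey g1)].
Qed.

Lemma ext_sqr_eq1 x y s t :
  ((Ext x y s t : E) ^+ 2 == 1) =
  if s then (p == t && r) && (q == t && oddz x)
  else (x + x == 0)%R && (y + y + tw (t && oddz x) == 0)%R.
Proof.
rewrite ext_sqr; case: s; rewrite extA_eq1 // zz_eq0 tw_eq0.
by congr (_ && _); [case: p; case: (t && r) | case: q; case: (t && oddz x)].
Qed.

Definition sqr1_set : {set E} := [set g | g ^+ 2 == 1].

End Extension.

(** A map of sets only, used to inject the solutions of one group into those of another. *)
Definition relabel n p q r p' q' r' (f : bool -> bool -> bool)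
    (g : ext n p q r) : ext n p' q' r' :=
  Ext (ex g) (ey g) (es g) (f (es g) (et g)).

Lemma isog_card_sqr1 (aT rT : finGroupType) (G : {group aT}) (H : {group rT}) :
  G \isog H ->
  #|[set g in G | g ^+ 2 == 1]| = #|[set h in H | h ^+ 2 == 1]|.
Proof.
case/isogP=> f injf imf; rewrite -imf.
suff <- : f @* [set g in G | g ^+ 2 == 1] = [set h in f @* G | h ^+ 2 == 1].
  by rewrite card_injm // setIdE subsetIl.
apply/setP=> h; rewrite inE; apply/morphimP/andP=> [[g Gg] | [/morphimP[g Gg _ ->]]].
  by rewrite inE => /andP[_ /eqP g2] ->; rewrite mem_morphim // -morphX // g2 morph1.
by rewrite -morphX // morph_injm_eq1 ?groupX // => g2; exists g; rewrite // inE Gg.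
Qed.

Lemma isog_ext_sqr1 n p q r p' q' r' :
  [set: ext n p q r] \isog [set: ext n p' q' r'] ->
  #|sqr1_set n p q r| = #|sqr1_set n p' q' r'|.
Proof. by move/isog_card_sqr1; congr (_ = _); apply: eq_card => g; rewrite !inE. Qed.

Lemma card_sqr1_ltn_relabel n p q r p' q' r' (f : bool -> bool -> bool) h :
  let F := relabel n p q r p' q' r' f in
  {in sqr1_set n p q r, forall g, F g \in sqr1_set n p' q' r'} ->
  {in sqr1_set n p q r &, injective F} ->
  h \in sqr1_set n p' q' r' ->
  {in sqr1_set n p q r, forall g, F g != h} ->
  (#|sqr1_set n p q r| < #|sqr1_set n p' q' r'|)%N.
Proof.
move=> F sF injF hI Fh; rewrite -(card_in_imset injF); apply: proper_card.
apply/properP; split; first by apply/subsetP=> _ /imsetP[g /sF gI ->].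
by exists h => //; apply/imsetP=> -[g /Fh /eqP ne /esym].
Qed.

(** With p alone no solution involves s; with q alone x s t is one. *)
Lemma card_sqr1_p_q n :
  (#|sqr1_set n true false false| < #|sqr1_set n false true false|)%N.
Proof.
apply: (card_sqr1_ltn_relabel _ _ _ _ _ _ _ (fun s t => t) (Ext 1%R 0%R true true)).
- by case=> x y s t; rewrite !inE /relabel !ext_sqr_eq1; case: s; case: t.
- by case=> x y s t [x' y' s' t'] _ _ [-> -> -> ->].
- by rewrite inE ext_sqr_eq1 oddz1.
by case=> x y s t; rewrite inE ext_sqr_eq1; apply: contraTneq => -[-> _ -> ->].
Qed.

(** The solutions x^i y^k s t, i odd, are moved into A s, which consists of solutions for r alone; s
    itself is missed. *)
Lemma card_sqr1_q_r n :
  (#|sqr1_set n false true false| < #|sqr1_set n false false true|)%N.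
Proof.
apply: (card_sqr1_ltn_relabel _ _ _ _ _ _ _ (fun s t => t && ~~ s) (Ext 0%R 0%R true false)).
- by case=> x y s t; rewrite !inE /relabel !ext_sqr_eq1; case: s; case: t.
- case=> x y s t [x' y' s' t']; rewrite !inE !ext_sqr_eq1 => + + [-> -> ss].
  by rewrite ss; case: s' {ss}; case: t; case: t'.
- by rewrite inE ext_sqr_eq1.
case=> x y s t; rewrite inE ext_sqr_eq1.
by apply: contraTneq; rewrite /relabel; case=> -> _ ->; case: t.
Qed.

(** Coordinates are kept; s t is a new solution. *)
Lemma card_sqr1_r_0 n :
  (#|sqr1_set n false false true| < #|sqr1_set n false false false|)%N.
Proof.
apply: (card_sqr1_ltn_relabel _ _ _ _ _ _ _ (fun s t => t) (Ext 0%R 0%R true true)).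
- by case=> x y s t; rewrite !inE /relabel !ext_sqr_eq1; case: s; case: t.
- by case=> x y s t [x' y' s' t'] _ _ [-> -> -> ->].
- by rewrite inE ext_sqr_eq1 oddz0.
by case=> x y s t; rewrite inE ext_sqr_eq1; apply: contraTneq => -[-> _ -> ->].
Qed.

Theorem theorem1p1 :
  exists (gT : 'I_4 -> nat -> finGroupType)
         (H : forall (k : 'I_4) (j : nat), {group gT k j}),
    (forall (k : 'I_4) (j : nat), 1 <= j ->
       [/\ 2.-group (H k j),
           'm(H k j) = 4,
           #|H k j| = (2 ^ (5 + j))%N,
           nil_class (H k j) = j.+1
         & Out_c (H k j) != 1])
    /\ (forall (k l : 'I_4) (j : nat), 1 <= j -> k != l ->
          ~~ (H k j \isog H l j)).
Proof.
(* Parameter n gives order 2^(n+6) and class n + 2, whence n = j - 1. *)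
pose gT (k : 'I_4) j : finGroupType :=
  ext j.-1 (k == 3 :> nat) (k == 2 :> nat) (k == 1%N :> nat).
exists gT, (fun k j => [set: gT k j]%G); split=> [k [//|n] _ | k l [//|n] _ ne_kl].
  split; rewrite ?pgroup_ext ?grank_ext ?nil_class_ext ?Out_c_ext //.
  by rewrite card_ext addnC.
apply/negP=> /isog_ext_sqr1 eq_kl.
pose N p q r := #|sqr1_set n p q r|.
have {eq_kl}: N (k == 3 :> nat) (k == 2 :> nat) (k == 1%N :> nat) =
  N (l == 3 :> nat) (l == 2 :> nat) (l == 1%N :> nat) by [].
(* The counts increase strictly from k = 3 down to k = 0, so equal counts force equal indices. *)
have := conj (card_sqr1_p_q n) (conj (card_sqr1_q_r n) (card_sqr1_r_0 n)).
rewrite -!/(N _ _ _); move: N => N.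
case: k l ne_kl => [[|[|[|[|//]]]] ?] [[|[|[|[|//]]]] ?] //= _ [? [? ?]];
  by rewrite !eqE /= => ?; lia.
Qed.
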